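(* Let $(\Theta,d_\Theta)$ be a totally bounded metric space, $(\mathcal{X},d_{\mathcal{X}})$ a metric space, and $(X_\theta)_{\theta\in\Theta}$ an $\mathcal{X}$-valued random process on a probability space $(\Omega,\mathcal{F},\mathbb{P})$. Assume: (i) $C,t>0$ are constants such that $N(\Theta,d_\Theta,\eta)\le C\eta^{-t}$ for all $\eta\in\,]0,\Delta(\Theta)]$; (ii) for all $(\theta,\vartheta)\in\Theta^2$ with $\theta\neq\vartheta$, the map $(X_\theta,X_\vartheta)$ is $\mathcal{F}|\mathcal{B}(\mathcal{X}^2)$-measurable; (iii) $M,p>0$ and $q>t$ are constants such that $\mathbb{E}[d_{\mathcal{X}}(X_\theta,X_\vartheta)^p]\le M\,d_\Theta(\theta,\vartheta)^q$ for all $\theta,\vartheta\in\Theta$. Then, for any $\beta\in\,]0,(q-t)/p[$, there exists a finite constant $\overline{L}(\Theta,C,t,p,q,\beta)$, depending only on $\Delta(\Theta),C,t,p,q$ and $\beta$, such that for every at most countable subset $\overline{\Theta}\subseteq\Theta$ with $\Delta(\overline{\Theta})>0$, $$\mathbb{E}\left[\sup_{\theta,\vartheta\in\overline{\Theta},\ \theta\neq\vartheta}\frac{d_{\mathcal{X}}(X_\theta,X_\vartheta)^p}{d_\Theta(\theta,\vartheta)^{\beta p}}\right]\le L(\Theta,C,t,M,p,q,\beta):=M\,\overline{L}(\Theta,C,t,p,q,\beta).$$ In particular, if $d_{\mathcal{X}}$ is complete, then $(X_\theta)_{\theta\in\Theta}$ has a modification $(\widetilde X_\theta)_{\theta\in\Theta}$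 such that $(\widetilde X_\theta,\widetilde X_\vartheta)$ is $\mathcal{F}|\mathcal{B}(\mathcal{X}^2)$-measurable for all $\theta\neq\vartheta$ in $\Theta$ and all paths of $(\widetilde X_\theta)_{\theta\in\Theta}$ are Hölder-continuous of all orders $\beta\in\,]0,(q-t)/p[$.
   Context: For $\overline{\Theta}\subseteq\Theta$, $\Delta(\overline{\Theta})$ is the diameter of $\overline{\Theta}$ w.r.t. $d_\Theta$, and $N(\overline{\Theta},d_\Theta,\eta)$ is the minimal number of closed $d_\Theta$-balls of radius $\eta>0$ with centers in $\overline{\Theta}$ needed to cover $\overline{\Theta}$. $\mathcal{B}(\cdot)$ denotes the Borel $\sigma$-algebra, and $\mathcal{X}^2$ carries the product topology. An $\mathcal{X}$-valued random process is a family $(X_\theta)_{\theta\in\Theta}$ of $\mathcal{F}|\mathcal{B}(\mathcal{X})$-measurable maps $X_\theta:\Omega\to\mathcal{X}$. A modification of $(X_\theta)_{\theta\in\Theta}$ is a process $(\widetilde X_\theta)_{\theta\in\Theta}$ with $\mathbb{P}(\widetilde X_\theta=X_\theta)=1$ for every $\theta\in\Theta$. $]a,b[$ denotes an open interval, $]a,b]$ a half-open one. The metric spaces are not assumed separable beyond what total boundedness of $\Theta$ implies. *)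

(* Defs.v *)
From mathcomp Require Import all_boot all_order all_algebra finmap.
From mathcomp Require Import all_classical all_reals all_analysis.

Set Implicit Arguments.
Unset Strict Implicit.
Unset Printing Implicit Defensive.

Import Order.TTheory GRing.Theory Num.Theory.
Import numFieldNormedType.Exports.

Local Open Scope classical_set_scope.
Local Open Scope ring_scope.

Section metric.
Context {R : realType} {T : metricType R}.

(* The library's [closed_ball] is the closure of the open ball, which in a
   general metric space may be smaller than the set of points at distance at
   most [r]. *)
Definition closed_mball (x : T) (r : R) : set T := [set y | mdist x y <= r].

(* The point [0] only matters for [A = set0], whose diameter is [0]. *)
Definition diam (A : set T) : \bar R :=
  ereal_sup (0%:E |` [set (mdist z.1 z.2)%:E | z in A `*` A]).

(* [+oo] when no finite cover exists. *)
Definition covering_number (A : set T) (eta : R) : \bar R :=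
  ereal_inf [set (#|` F|)%fset%:R%:E | F in
    [set F : {fset T} | [set` F] `<=` A /\
                        A `<=` \bigcup_(x in [set` F]) closed_mball x eta]].

Definition totally_bounded (A : set T) : Prop :=
  forall e : R, 0 < e ->
    exists F : {fset T}, A `<=` \bigcup_(x in [set` F]) ball x e.

(* The library's [cvg] and [completeType] require a pointed type; [T] may be
   any metric space here. *)
Definition complete_metric : Prop :=
  forall u : nat -> T, cauchy (u @ \oo) -> exists l : T, u @ \oo --> l.

End metric.
Arguments complete_metric {R} T.

Definition holder_continuous {R : realType} {T S : metricType R} (beta : R)
    (f : T -> S) : Prop :=
  exists K : R, forall x y, mdist (f x) (f y) <= K * mdist x y `^ beta.

(* Unfolds [measurable_fun setT f] with the sigma-algebra generated by the open
   sets on the codomain; [g_sigma_algebraType] would require a pointed type. *)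
Definition borel_measurable {d : measure_display} {Omega : measurableType d}
    {S : topologicalType} (f : Omega -> S) : Prop :=
  forall B : set S, <<s @open S >> B -> measurable (f @^-1` B).

Definition random_process {d : measure_display} {Omega : measurableType d}
    {I : Type} {S : topologicalType} (X : I -> Omega -> S) : Prop :=
  forall i, borel_measurable (X i).

(* [P] is a total function on sets, so the measurability of the event has to be
   stated. *)
Definition modification {R : realType} {d : measure_display}
    {Omega : measurableType d} (P : probability Omega R)
    {I : Type} {S : topologicalType} (X Y : I -> Omega -> S) : Prop :=
  random_process Y /\
  forall i, measurable [set w | Y i w = X i w] /\
            P [set w | Y i w = X i w] = 1%E.

(* Main.v *)
Require Import Defs.
From mathcomp Require Import all_boot all_order all_algebra finmap.
From mathcomp Require Import all_classical all_reals all_analysis.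
From mathcomp Require Import measurable_realfun.
From mathcomp Require Import ring lra.

Set Implicit Arguments.
Unset Strict Implicit.
Unset Printing Implicit Defensive.

Import Order.TTheory GRing.Theory Num.Theory.
Import numFieldNormedType.Exports.

Local Open Scope classical_set_scope.
Local Open Scope ring_scope.

(** The proof is a chaining argument along nets [G k] of radius [D / 2 ^+ k],
    where [D] is the diameter; by the covering hypothesis [G k] has a number of
    points of order [2 `^ (t * k)].  Two points of a set at distance about
    [D / 2 ^+ k] are replaced by close points of [G k], and each of them is
    reached from there through the finer nets, so that the increment of a path
    is bounded by increments between close points of consecutive nets.

    A net of [N] points may have of the order of [N ^+ 2] close pairs, and
    summing the moments over all of them would require [q > 2 * t].  This is
    overcome by [pair_reduction]: about [N `^ (1 + m^-1)] pairs, at the price of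
    a distance that is [m] times larger, already control every close pair
    through a common third point.  For fixed [m] the number of pairs at level
    [k] is of order [2 `^ (t * (1 + m^-1) * k)], and since [b * p < q - t] one
    can take [m] with [b * p + t * (1 + m^-1) < q].

    The moments are summed without any convexity in [p].  The random variable
    [V = \sum_k 2 `^ (b * p * k) * \sum_(z <- U k) mdist (X z.1) (X z.2) `^ p]
    has an expectation which is a convergent geometric series, proportional to
    [M]; and every increment at level [k] is at most [V `^ p^-1 * 2 `^ (- b * k)],
    so that the increments along a chain again sum geometrically
    ([holder_of_increments], [holder_envelope]).  This works for all [p > 0].

    To reach the points of a countable set after finitely many steps, the first
    [2 `^ (t * k)] points of an enumeration are added to the net [G k].  The
    bound then holds for every path, and no limit along the chain is taken.

    For the modification, apply the bound to a dense sequence and to exponents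
    increasing to [(q - t) / p].  On the event where all the suprema are finite,
    which has probability 1, the paths are Hoelder on the dense sequence and
    extend by completeness; elsewhere they are replaced by a constant path.
    The extension agrees almost surely with the process at a given point because
    the bound also applies to the dense sequence with this point added.  As the
    state space need not be separable, measurability of pairs is not inherited
    from the components: it is carried through the pointwise limit of pairs
    ([borel_measurable_cvg]). *)

(** * Reducing the number of close pairs *)

(** From a point [z] of [s], the cardinality of the balls of radius [r * c],
    [r <= m], cannot be multiplied by more than [a] at each of the [m] steps, as
    [size s <= a ^+ m].  Hence some ball of radius [r * c] has an enlargement by
    [c] with at most [a] times as many points.  Link [z] to this enlargement,
    which contains every point close to the small ball, remove the small ball,
    and iterate: each removed point pays for at most [a] links. *)
Lemma pair_reduction (R : realType) (T : metricType R) (a c : R) (m : nat)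
    (s : seq T) :
  0 <= a -> 0 <= c -> (0 < m)%N -> (size s)%:R <= a ^+ m ->
  exists U : seq (T * T),
    [/\ (size U)%:R <= a * (size s)%:R,
        forall z, z \in U -> mdist z.1 z.2 <= m%:R * c &
        forall x y, x \in s -> y \in s -> mdist x y <= c ->
          exists z, (z, x) \in U /\ (z, y) \in U].
Proof.
move=> a0 c0 m0.
have [n] := ubnP (size s); elim: n s => // n IH [|z s'] sn sm.
  by exists [::]; split => //=; rewrite mulr0.
set s := z :: s' in sn sm *.
pose B r := [seq y <- s | mdist z y <= r%:R * c].
have zB r : z \in B r by rewrite mem_filter inE eqxx mdistxx mulr_ge0.
(* otherwise B m would have more than a ^+ m points *)
have [r rm Br] : exists2 r, (r < m)%N & (size (B r.+1))%:R <= a * (size (B r))%:R.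
  apply: contrapT => noR.
  have grow r : (r < m)%N -> a * (size (B r))%:R < (size (B r.+1))%:R.
    by move=> rm; rewrite ltNge; apply/negP => Br; apply: noR; exists r.
  have ar r : (r < m)%N -> a ^+ r <= (size (B r))%:R.
    elim: r => [_|r IHr rm].
      by rewrite expr0 ler1n; case: (B 0%N) (zB 0%N).
    rewrite exprS; apply: le_trans (ltW (grow _ (ltnW rm))).
    by rewrite ler_wpM2l// IHr// ltnW.
  have m1 : (m.-1 < m)%N by rewrite prednK.
  have : a ^+ m < (size (B m))%:R.
    rewrite -(prednK m0) exprS; apply: le_lt_trans (grow _ m1).
    by rewrite ler_wpM2l// ar.
  apply/negP; rewrite -leNgt; apply: le_trans sm.
  by rewrite ler_nat size_filter count_size.
pose s2 := [seq y <- s | ~~ (mdist z y <= r%:R * c)].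
have szs : size s = (size (B r) + size s2)%N.
  by rewrite !size_filter count_predC.
have s2s : (size s2 < size s)%N.
  by rewrite szs -[ltnLHS]add0n ltn_add2r; case: (B r) (zB r).
have [||U2 [U2s U2c U2P]] := IH s2.
- exact: leq_trans s2s _.
- by apply: le_trans sm; rewrite ler_nat ltnW.
exists ([seq (z, y) | y <- B r.+1] ++ U2); split.
- by rewrite size_cat size_map szs !natrD mulrDr lerD.
- move=> u; rewrite mem_cat => /orP[/mapP[y + ->]|/U2c//] /=.
  rewrite mem_filter => /andP[+ _] => /le_trans; apply.
  by rewrite ler_wpM2r// ler_nat.
have near x y : x \in s -> y \in s -> mdist x y <= c ->
    mdist z x <= r%:R * c -> x \in B r.+1 /\ y \in B r.+1.
  move=> xs ys xyc zx; have rS : r.+1%:R * c = r%:R * c + c.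
    by rewrite -natr1 mulrDl mul1r.
  rewrite !mem_filter xs ys !andbT rS; split.
    by rewrite (le_trans zx)// lerDl.
  by rewrite (le_trans (metric_triangle z x y))// lerD.
have inU x : x \in B r.+1 -> (z, x) \in [seq (z, y) | y <- B r.+1] ++ U2.
  by move=> xB; rewrite mem_cat map_f.
move=> x y xs ys xyc.
have [zx|zx] := boolP (mdist z x <= r%:R * c).
  by have [xB yB] := near _ _ xs ys xyc zx; exists z; split; apply: inU.
have [zy|zy] := boolP (mdist z y <= r%:R * c).
  rewrite metric_sym in xyc.
  by have [yB xB] := near _ _ ys xs xyc zy; exists z; split; apply: inU.
have [||//|w [wx wy]] := U2P x y; rewrite ?mem_filter ?zx ?zy//.
by exists w; rewrite !mem_cat wx wy !orbT.
Qed.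

(** * Chaining along a fixed path *)

(** Going down the nets from [u] costs [c * r ^+ j] at each level [j >= k], a
    geometric series; the number [n] of levels does not enter the bound. *)
Lemma chain_to_point (R : realType) (T S : metricType R) (f : T -> S)
    (G : nat -> seq T) (eta : nat -> R) (c r : R) :
  0 <= c -> 0 <= r -> r < 1 ->
  (forall k, 0 <= eta k /\ eta k.+1 <= eta k) ->
  (forall k x, exists2 u, u \in G k & mdist x u <= eta k) ->
  (forall k u v, u \in G k -> v \in G k ++ G k.+1 -> mdist u v <= 3 * eta k ->
     mdist (f u) (f v) <= c * r ^+ k) ->
  forall n k u x, x \in G (k + n)%N -> u \in G k -> mdist x u <= eta k ->
    mdist (f u) (f x) <= c * r ^+ k / (1 - r).
Proof.
move=> c0 r0 r1 eta_dec net step; have r1' : 0 < 1 - r by rewrite subr_gt0.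
elim=> [|n IH] k u x.
  rewrite addn0 => xG uG xu; rewrite (@le_trans _ _ (c * r ^+ k))//.
    apply: step => //; first by rewrite mem_cat xG.
    by rewrite metric_sym (le_trans xu)// ler_peMl ?ler1n//; have [] := eta_dec k.
  by rewrite ler_pdivlMr// ler_piMr ?mulr_ge0 ?exprn_ge0// lerBlDr lerDl.
rewrite addnS -addSn => xG uG xu.
have [v vG xv] := net k.+1 x.
have [eta0 etaS] := eta_dec k.
have uv : mdist u v <= 3 * eta k.
  rewrite (le_trans (metric_triangle u x v))// (metric_sym u).
  by rewrite (@le_trans _ _ (eta k + eta k))//; [rewrite lerD// (le_trans xv)|lra].
have fuv := step _ _ _ uG _ uv; rewrite mem_cat vG orbT in fuv.
have fvx := IH _ _ _ xG vG xv.
apply: le_trans (metric_triangle (f u) (f v) (f x)) _.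
apply: le_trans (lerD (fuv isT) fvx) _.
suff -> : c * r ^+ k / (1 - r) = c * r ^+ k + c * r ^+ k.+1 / (1 - r) by [].
by rewrite exprS; field; rewrite gt_eqF.
Qed.

Lemma chain_between_points (R : realType) (T S : metricType R) (f : T -> S)
    (G : nat -> seq T) (eta : nat -> R) (c r : R) :
  0 <= c -> 0 <= r -> r < 1 ->
  (forall k, 0 <= eta k /\ eta k.+1 <= eta k) ->
  (forall k x, exists2 u, u \in G k & mdist x u <= eta k) ->
  (forall k u v, u \in G k -> v \in G k ++ G k.+1 -> mdist u v <= 3 * eta k ->
     mdist (f u) (f v) <= c * r ^+ k) ->
  forall k x y,
    (exists n, x \in G (k + n)%N) -> (exists n, y \in G (k + n)%N) ->
    mdist x y <= eta k ->
    mdist (f x) (f y) <= 3 * (c * r ^+ k / (1 - r)).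
Proof.
move=> c0 r0 r1 eta_dec net step k x y [n xG] [n' yG] xy.
have [u uG xu] := net k x; have [v vG yv] := net k y.
have uv : mdist u v <= 3 * eta k.
  apply: le_trans (metric_triangle u x v) _.
  have := metric_triangle x y v; rewrite (metric_sym u); lra.
have fux := chain_to_point c0 r0 r1 eta_dec net step xG uG xu.
have fvy := chain_to_point c0 r0 r1 eta_dec net step yG vG yv.
have fuv := step _ _ _ uG _ uv; rewrite mem_cat vG in fuv.
have r1' : 0 < 1 - r by rewrite subr_gt0.
have {fuv} fuv : mdist (f u) (f v) <= c * r ^+ k / (1 - r).
  rewrite (le_trans (fuv isT))// ler_pdivlMr// ler_piMr ?mulr_ge0 ?exprn_ge0//.
  by rewrite lerBlDr lerDl.
have := metric_triangle (f x) (f u) (f y); have := metric_triangle (f u) (f v) (f y).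
rewrite (metric_sym (f x) (f u)); lra.
Qed.

(** * Nets and their pairs *)

Lemma bernoulli_ineq (R : realDomainType) (x : R) n :
  0 <= x -> 1 + n%:R * x <= (1 + x) ^+ n.
Proof.
move=> x0; elim: n => [|n IH]; first by rewrite mul0r addr0 expr0.
rewrite exprS; apply: le_trans (ler_wpM2l _ IH); last by rewrite addr_ge0.
have : 0 <= n%:R * (x * x) by rewrite !mulr_ge0.
by rewrite -natr1; lra.
Qed.

Lemma expr_unbounded (R : archiRealFieldType) (x a : R) :
  1 < x -> exists n, a <= x ^+ n.
Proof.
move=> x1; have x1' : 0 < x - 1 by rewrite subr_gt0.
exists (Num.truncn (a / (x - 1))).+1.
have := bernoulli_ineq (Num.truncn (a / (x - 1))).+1 (ltW x1').
rewrite (_ : 1 + (x - 1) = x); last by ring.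
apply: le_trans.
rewrite -[leLHS]add0r lerD// -ler_pdivrMr//.
by rewrite ltW// truncnS_gt.
Qed.

Lemma powR_expAC (R : realType) (x y : R) k :
  0 <= x -> (x ^+ k) `^ y = (x `^ y) ^+ k.
Proof. by move=> x0; rewrite -powR_mulrn// powRAC powR_mulrn// powR_ge0. Qed.

Lemma gt1_ltr_powR (R : realType) (a x y : R) :
  1 < a -> x < y -> a `^ x < a `^ y.
Proof.
move=> a1 xy; rewrite /powR gt_eqF ?(lt_trans _ a1)// ltr_expR.
by rewrite ltr_pM2r// ln_gt0.
Qed.

Definition covers (R : realType) (T : metricType R) (s : seq T) (eta : R) :=
  forall x, exists2 u, u \in s & mdist x u <= eta.

Definition scale (R : realType) (D : R) (k : nat) : R := D / 2 ^+ k.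

Lemma scale_ge0 (R : realType) (D : R) k : 0 <= D -> 0 <= scale D k.
Proof. by move=> D0; rewrite divr_ge0// exprn_ge0. Qed.

Lemma scaleS (R : realType) (D : R) k : scale D k = 2 * scale D k.+1.
Proof. by rewrite /scale exprS; field; rewrite expf_neq0. Qed.

(** The factor [1 + 2 `^ t] accounts for two consecutive nets taken together,
    and the summand 1 for the points of the sequence added to each net. *)
Definition net_const (R : realType) (D C t : R) : R :=
  (C * D `^ (- t) + 1) * (1 + 2 `^ t).

(** Adding [e i] for [i.+1 <= 2 `^ (t * k)] to the net of level [k] does not change
    the order of its cardinality, and puts each [e i] in all nets from some
    level on. *)
Lemma nets_with_sequence (R : realType) (T : metricType R) (D C t : R)
    (e : nat -> T) :
  0 < D -> 0 < C -> 0 < t ->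
  (forall eta, 0 < eta -> eta <= D ->
     exists2 s : seq T, (size s)%:R <= C * eta `^ (- t) & covers s eta) ->
  exists G : nat -> seq T,
    [/\ forall k, covers (G k) (scale D k),
        forall i k, exists n, e i \in G (k + n)%N &
        forall k, (size (G k ++ G k.+1))%:R <= net_const D C t * (2 `^ t) ^+ k].
Proof.
move=> D0 C0 t0 nets; set x := 2 `^ t.
have x1 : 1 < x.
  by rewrite /x -[ltLHS](powRr0 2) gt1_ltr_powR// ltr1n.
have x0 : 0 < x by apply: lt_trans x1.
have /choice[s sP] : forall k, exists s : seq T,
    (size s)%:R <= C * D `^ (- t) * x ^+ k /\ covers s (scale D k).
  move=> k; have s0 : 0 < scale D k by rewrite divr_gt0// exprn_gt0.
  have [||s ss sc] := nets (scale D k) => //.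
    by rewrite ler_pdivrMr ?exprn_gt0// ler_peMr ?(ltW D0)// exprn_ege1// ler1n.
  exists s; split => //; apply: le_trans ss _.
  rewrite -mulrA ler_wpM2l// ?(ltW C0)// /scale powRM ?(ltW D0)//.
  by rewrite -powR_inv1 ?exprn_ge0// -powRrM mulN1r opprK powR_expAC.
exists (fun k => s k ++ [seq e i | i <- iota 0 (Num.truncn (x ^+ k))]).
have szG k : (size (s k ++ [seq e i | i <- iota 0 (Num.truncn (x ^+ k))]))%:R <=
    (C * D `^ (- t) + 1) * x ^+ k.
  rewrite size_cat size_map size_iota natrD mulrDl mul1r lerD//.
    by have [] := sP k.
  by rewrite truncn_le// exprn_ge0// ltW.
split.
- move=> k y; have [_ /(_ y)[u us yu]] := sP k.
  by exists u => //; rewrite mem_cat us.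
- move=> i k; have [n ni] := expr_unbounded i.+1%:R x1.
  exists n; rewrite mem_cat map_f ?orbT// mem_iota add0n leq0n/=.
  rewrite truncn_ge_nat ?exprn_ge0 ?(ltW x0)// (le_trans ni)//.
  by rewrite exprD ler_peMl ?exprn_ge0 ?(ltW x0)// exprn_ege1// ltW.
- move=> k; rewrite size_cat natrD (le_trans (lerD (szG k) (szG k.+1)))//.
  by rewrite /net_const exprS mulrA -mulrDl; rewrite -/x; lra.
Qed.

(** The growth exponent of the number of pairs left by [pair_reduction] when the
    nets grow with exponent [t]. *)
Definition pair_rate (R : realType) (t : R) (m : nat) : R := t * (1 + m%:R^-1).

(** [pair_reduction] applied to two consecutive nets at once, so that the pairs
    of [U k] control both the steps from one net to the next and the close pairs
    inside a net.  The factor of growth is the [m]-th root of the bound on the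
    cardinality of the nets, which keeps [m], hence the loss in distance, the
    same at all levels. *)
Lemma chaining_pairs (R : realType) (T : metricType R) (D C t : R) (m : nat)
    (e : nat -> T) :
  0 < D -> 0 < C -> 0 < t -> (0 < m)%N ->
  (forall eta, 0 < eta -> eta <= D ->
     exists2 s : seq T, (size s)%:R <= C * eta `^ (- t) & covers s eta) ->
  exists (G : nat -> seq T) (U : nat -> seq (T * T)),
    [/\ forall k, covers (G k) (scale D k),
        forall i k, exists n, e i \in G (k + n)%N,
        forall k, (size (U k))%:R <= net_const D C t `^ (1 + m%:R^-1)
                                     * (2 `^ pair_rate t m) ^+ k,
        forall k z, z \in U k -> mdist z.1 z.2 <= 3 * m%:R * scale D k &
        forall k x y, x \in G k -> y \in G k ++ G k.+1 ->
          mdist x y <= 3 * scale D k ->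
          exists z, (z, x) \in U k /\ (z, y) \in U k].
Proof.
move=> D0 C0 t0 m0 nets.
have [G [Gc Ge Gs]] := nets_with_sequence e D0 C0 t0 nets.
set N := net_const D C t in Gs *.
have N0 : 0 <= N by rewrite !(mulr_ge0, addr_ge0, powR_ge0)// ltW.
have Nk0 k : 0 <= N * (2 `^ t) ^+ k by rewrite mulr_ge0// exprn_ge0// powR_ge0.
have /choice[U UP] : forall k, exists U : seq (T * T),
    [/\ (size U)%:R <= (N * (2 `^ t) ^+ k) `^ m%:R^-1 * (size (G k ++ G k.+1))%:R,
        forall z, z \in U -> mdist z.1 z.2 <= m%:R * (3 * scale D k) &
        forall x y, x \in G k ++ G k.+1 -> y \in G k ++ G k.+1 ->
          mdist x y <= 3 * scale D k -> exists z, (z, x) \in U /\ (z, y) \in U].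
  move=> k; apply: pair_reduction => //; first exact: powR_ge0.
    by rewrite mulr_ge0// scale_ge0// ltW.
  rewrite -powR_mulrn ?powR_ge0// -powRrM mulVf ?pnatr_eq0 -?lt0n// powRr1//.
exists G, U; split => //.
- move=> k; have [Us _ _] := UP k.
  apply: le_trans Us _; apply: le_trans (ler_wpM2l (powR_ge0 _ _) (Gs k)) _.
  have m1 : (0 : R) < 1 + m%:R^-1 by rewrite addr_gt0// invr_gt0 ltr0n.
  rewrite /pair_rate powRrM -(powR_expAC (1 + m%:R^-1) k (powR_ge0 2 t)).
  rewrite -powRM ?exprn_ge0 ?powR_ge0//.
  by rewrite -(mulr_powRB1 (Nk0 k) m1) addrAC subrr add0r mulrC.
- by move=> k z zU; have [_ /(_ z zU)] := UP k; rewrite mulrCA mulrA.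
- by move=> k x y xG yG; have [_ _] := UP k; apply => //; rewrite mem_cat xG.
Qed.

(** * From increments over the pairs to a Hoelder bound *)

Definition increments (R : realType) (T S : metricType R) (p : R) (f : T -> S)
  (U : seq (T * T)) : R := \sum_(z <- U) mdist (f z.1) (f z.2) `^ p.

Lemma increments_ge0 (R : realType) (T S : metricType R) (p : R) (f : T -> S)
  (U : seq (T * T)) : 0 <= increments p f U.
Proof. by apply: sumr_ge0 => z _; exact: powR_ge0. Qed.

Definition holder_const (R : realType) (D p b : R) : R :=
  (6 * (2 / D) `^ b / (1 - 2 `^ (- b))) `^ p.

(** One real number [V] bounding the weighted sums of all levels gives increments
    of at most [V `^ p^-1 * 2 `^ (- b * k)] over the pairs of level [k], hence at
    most twice that for close points of the nets, which are linked through a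
    third point.  Chaining from the level [k] comparable to [mdist x y] ends the
    proof. *)
Lemma holder_of_increments (R : realType) (T S : metricType R) (f : T -> S)
    (G : nat -> seq T) (U : nat -> seq (T * T)) (D p b V : R) :
  0 < D -> 0 < p -> 0 < b -> 0 <= V ->
  (forall k, covers (G k) (scale D k)) ->
  (forall k x y, x \in G k -> y \in G k ++ G k.+1 ->
     mdist x y <= 3 * scale D k -> exists z, (z, x) \in U k /\ (z, y) \in U k) ->
  (forall k, (2 `^ (b * p)) ^+ k * increments p f (U k) <= V) ->
  forall x y,
    (forall k, exists n, x \in G (k + n)%N) ->
    (forall k, exists n, y \in G (k + n)%N) ->
    0 < mdist x y -> mdist x y <= D ->
    mdist (f x) (f y) `^ p <= holder_const D p b * V * mdist x y `^ (b * p).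
Proof.
move=> D0 p0 b0 V0 Gc link UV x y xG yG xy0 xyD.
set r : R := 2 `^ (- b).
have r0 : 0 < r by rewrite powR_gt0.
have r1 : r < 1.
  rewrite /r -[X in _ < X](powRr0 2) gt1_ltr_powR ?ltr1n//.
  by rewrite oppr_lt0.
have r1' : 0 < 1 - r by rewrite subr_gt0.
set v := V `^ p^-1; have v0 : 0 <= v by rewrite powR_ge0.
have vp : v `^ p = V by rewrite -powRrM mulVf ?gt_eqF// powRr1.
have le_of_powR (a c : R) : 0 <= c -> a `^ p <= c `^ p -> a <= c.
  move=> c0; apply: contraTT; rewrite -!ltNge => ca.
  by rewrite gt0_ltr_powR// nnegrE// (le_trans c0)// ltW.
have pair_bound k z : z \in U k -> mdist (f z.1) (f z.2) <= v * r ^+ k.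
  move=> zU; apply: le_of_powR; first by rewrite mulr_ge0// exprn_ge0// ltW.
  rewrite powRM// ?exprn_ge0 ?(ltW r0)// vp powR_expAC ?(ltW r0)//.
  rewrite -[r `^ p]powRrM mulNr powRN exprVn ler_pdivlMr ?exprn_gt0 ?powR_gt0//.
  apply: le_trans (UV k); rewrite mulrC ler_wpM2l ?exprn_ge0 ?powR_ge0//.
  rewrite /increments (big_rem z)//= lerDl.
  by apply: sumr_ge0 => ? _; exact: powR_ge0.
have step k u w : u \in G k -> w \in G k ++ G k.+1 ->
    mdist u w <= 3 * scale D k -> mdist (f u) (f w) <= 2 * v * r ^+ k.
  move=> uG wG uw; have [z [zu zw]] := link k u w uG wG uw.
  have := pair_bound k _ zu; have := pair_bound k _ zw => /=.
  have := metric_triangle (f u) (f z) (f w); rewrite (metric_sym (f u) (f z)); lra.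
have [k /andP[kxy xyk]] : exists k, scale D k.+1 <= mdist x y <= scale D k.
  have [n Dn] := expr_unbounded (D / mdist x y) (ltr1n R 2).
  have {}Dn : scale D n <= mdist x y.
    by rewrite ler_pdivrMr ?exprn_gt0// -ler_pdivrMl// mulrC.
  elim: n Dn => [|n IH] Dn.
    exists 0%N; rewrite /scale expr0 divr1 xyD andbT; apply: le_trans Dn.
    by rewrite [leRHS]scaleS ler_peMl ?ler1n// scale_ge0// ltW.
  have [|xyn] := leP (scale D n) (mdist x y); first exact: IH.
  by exists n; rewrite Dn ltW.
have scale_dec j : 0 <= scale D j /\ scale D j.+1 <= scale D j.
  have := scale_ge0 j (ltW D0); have := scale_ge0 j.+1 (ltW D0).
  by rewrite (scaleS D j); lra.
have v20 : 0 <= 2 * v by rewrite mulr_ge0.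
have fxy := chain_between_points v20 (ltW r0) r1 scale_dec Gc step
  (xG k) (yG k) xyk.
have rk : r ^+ k <= (2 / D) `^ b * mdist x y `^ b.
  have -> : r ^+ k = (2 / D) `^ b * scale D k.+1 `^ b.
    rewrite -powRM ?scale_ge0 ?divr_ge0 ?(ltW D0)//.
    rewrite (_ : 2 / D * scale D k.+1 = (2 ^+ k)^-1).
      by rewrite -exprVn powR_expAC ?invr_ge0// -powR_inv1// -powRrM mulN1r.
    by rewrite /scale exprS; field; rewrite expf_neq0//= gt_eqF.
  rewrite ler_wpM2l ?powR_ge0//.
  by rewrite ge0_ler_powR ?nnegrE ?(ltW b0) ?scale_ge0 ?(ltW D0) ?(ltW xy0).
have K0 : 0 <= 6 * (2 / D) `^ b / (1 - r).
  by rewrite divr_ge0 ?(ltW r1')// mulr_ge0// powR_ge0.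
have ir0 : 0 <= (1 - r)^-1 by rewrite invr_ge0 ltW.
rewrite /holder_const -/r mulrAC -vp (powRrM _ b) -!powRM ?mulr_ge0 ?powR_ge0//.
rewrite ge0_ler_powR ?nnegrE ?(ltW p0) ?mdist_ge0//.
  by rewrite !mulr_ge0 ?powR_ge0.
apply: le_trans fxy _.
rewrite [leLHS](_ : _ = 6 * v / (1 - r) * r ^+ k); last by field; rewrite gt_eqF.
rewrite [leRHS](_ : _ = 6 * v / (1 - r) * ((2 / D) `^ b * mdist x y `^ b)).
  by rewrite ler_wpM2l// divr_ge0 ?(ltW r1')// mulr_ge0.
by field; rewrite gt_eqF.
Qed.

(** * The moment bound *)

(** The least integer [m] with [t / m < q - t - b * p], that is, with
    [b * p + pair_rate t m < q]. *)
Definition pair_exponent (R : realType) (t p q b : R) : nat :=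
  (Num.truncn (t / (q - t - b * p))).+1.

Definition series_rate (R : realType) (t p q b : R) : R :=
  2 `^ (b * p + pair_rate t (pair_exponent t p q b) - q).

Definition term_const (R : realType) (D C t p q b : R) : R :=
  let m := pair_exponent t p q b in
  net_const D C t `^ (1 + m%:R^-1) * (3 * m%:R * D) `^ q.

Definition moment_const (R : realType) (D C t p q b : R) : R :=
  holder_const D p b * (term_const D C t p q b / (1 - series_rate t p q b)).

Lemma series_rate_lt1 (R : realType) (t p q b : R) :
  0 < t -> 0 < p -> b < (q - t) / p -> series_rate t p q b < 1.
Proof.
move=> t0 p0; rewrite ltr_pdivlMr// => bq.
have g0 : 0 < q - t - b * p by lra.
rewrite /series_rate -[X in _ < X](powRr0 2) gt1_ltr_powR ?ltr1n//.
rewrite /pair_rate; set m := pair_exponent _ _ _ _.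
have : t / (q - t - b * p) < m%:R by exact: truncnS_gt.
rewrite ltr_pdivrMr// mulrC -ltr_pdivrMr ?ltr0n// mulrDr mulr1; lra.
Qed.

Lemma nneseries_geometric_le (R : realType) (u : nat -> \bar R) (a z : R) :
  0 <= a -> 0 <= z -> z < 1 -> (forall k, (0 <= u k)%E) ->
  (forall k, (u k <= (a * z ^+ k)%:E)%E) ->
  (\sum_(0 <= k <oo) u k <= (a / (1 - z))%:E)%E.
Proof.
move=> a0 z0 z1 u0 ua; apply: lime_le; first exact: is_cvg_nneseries.
apply: nearW => n; apply: (@le_trans _ _ (\sum_(0 <= k < n) (a * z ^+ k)%:E)%E).
  by apply: lee_sum => k _; exact: ua.
rewrite sumEFin lee_fin.
have -> : \sum_(0 <= k < n) a * z ^+ k = a * (1 - z ^+ n) / (1 - z).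
  have := congr1 (@^~ n) (geometric_seriesE a (negbT (lt_eqF z1))).
  by rewrite seriesEnat.
by rewrite ler_pM2r ?invr_gt0 ?subr_gt0// ler_piMr// lerBlDr lerDl exprn_ge0.
Qed.

(** A measurable majorant [W] of all the Hoelder quotients.  Its expectation is
    computed term by term: at level [k] there are about
    [2 `^ (pair_rate t m * k)] pairs, each contributing at most a constant times
    [M * 2 `^ (- q * k)], with the weight [2 `^ (b * p * k)]; the ratio of the
    resulting geometric series is [series_rate t p q b < 1]. *)
Lemma holder_envelope (R : realType) (d : measure_display)
    (Omega : measurableType d) (mu : {measure set Omega -> \bar R})
    (T S : metricType R) (X : T -> Omega -> S) (D C t M p q b : R)
    (e : nat -> T) :
  0 < D -> 0 < C -> 0 < t -> 0 < M -> 0 < p -> 0 < b -> b < (q - t) / p ->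
  (forall x y : T, mdist x y <= D) ->
  (forall eta, 0 < eta -> eta <= D ->
     exists2 s : seq T, (size s)%:R <= C * eta `^ (- t) & covers s eta) ->
  (forall x y, measurable_fun setT (fun w => mdist (X x w) (X y w))) ->
  (forall x y, (\int[mu]_w (mdist (X x w) (X y w) `^ p)%:E
                 <= (M * mdist x y `^ q)%:E)%E) ->
  exists W : Omega -> \bar R,
    [/\ measurable_fun setT W, forall w, (0 <= W w)%E,
        (\int[mu]_w W w <= (M * moment_const D C t p q b)%:E)%E &
        forall w i j, e i <> e j ->
          ((mdist (X (e i) w) (X (e j) w) `^ p
              / mdist (e i) (e j) `^ (b * p))%:E <= W w)%E].
Proof.
move=> D0 C0 t0 M0 p0 b0 bq diamD nets mX momX.
set m := pair_exponent t p q b.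
have [G [U [Gc Ge Us Ud Ul]]] :=
  chaining_pairs e D0 C0 t0 (ltn0Sn _ : (0 < m)%N) nets.
have q0 : 0 < q by move: bq; rewrite ltr_pdivlMr//; have := mulr_gt0 b0 p0; lra.
pose f k w : \bar R :=
  ((2 `^ (b * p)) ^+ k * increments p (X ^~ w) (U k))%:E.
have f0 k w : (0 <= f k w)%E.
  by rewrite lee_fin mulr_ge0 ?increments_ge0// exprn_ge0// powR_ge0.
have mdp x y : measurable_fun setT (fun w => mdist (X x w) (X y w) `^ p).
  exact: measurableT_comp (measurable_powR _) (mX x y).
have mincr k : measurable_fun setT (fun w => increments p (X ^~ w) (U k)).
  by apply: measurable_sum => z; exact: mdp.
have mf k : measurable_fun setT (f k).
  by apply/measurable_EFinP; apply: measurable_funM.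
have h0 : 0 < holder_const D p b.
  rewrite powR_gt0// divr_gt0 ?mulr_gt0 ?powR_gt0 ?divr_gt0// subr_gt0.
  by rewrite -[X in _ < X](powRr0 2) gt1_ltr_powR ?ltr1n ?oppr_lt0.
have h0' := ltW h0.
have intf k : (\int[mu]_w f k w <=
    (M * term_const D C t p q b * series_rate t p q b ^+ k)%:E)%E.
  rewrite /f; under eq_integral do rewrite EFinM.
  rewrite ge0_integralZl_EFin//; last 2 first.
  - by move=> w _; rewrite lee_fin increments_ge0.
  - exact/measurable_EFinP.
  have -> : (\int[mu]_w (increments p (X ^~ w) (U k))%:E =
      \sum_(z <- U k) \int[mu]_w (mdist (X z.1 w) (X z.2 w) `^ p)%:E)%E.
    rewrite /increments; under eq_integral do rewrite -sumEFin.
    rewrite ge0_integral_sum//; first by move=> z; apply/measurable_EFinP.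
    by move=> z w _; rewrite lee_fin powR_ge0.
  apply: (@le_trans _ _ ((2 `^ (b * p) ^+ k)%:E *
      ((size (U k))%:R * (M * (3 * m%:R * scale D k) `^ q))%:E)%E).
    apply: lee_wpmul2l; first by rewrite lee_fin exprn_ge0// powR_ge0.
    rewrite -sum1_size natr_sum mulr_suml -sumEFin big_seq [leRHS]big_seq.
    apply: lee_sum => z zU; rewrite mul1r; apply: le_trans (momX _ _) _.
    rewrite lee_fin ler_wpM2l ?(ltW M0)// ge0_ler_powR ?nnegrE ?(ltW q0)//.
    - by rewrite mdist_ge0.
    - by rewrite mulr_ge0// scale_ge0// ltW.
    - exact: Ud.
  rewrite -EFinM lee_fin.
  apply: (@le_trans _ _ (2 `^ (b * p) ^+ k *
     (net_const D C t `^ (1 + m%:R^-1) * (2 `^ pair_rate t m) ^+ k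
       * (M * (3 * m%:R * scale D k) `^ q)))).
    rewrite ler_wpM2l ?exprn_ge0 ?powR_ge0// ler_wpM2r//.
    by rewrite mulr_ge0 ?powR_ge0// ltW.
  have -> : (3 * m%:R * scale D k) `^ q = (3 * m%:R * D) `^ q * (2 `^ (- q)) ^+ k.
    rewrite /scale mulrA powRM ?mulr_ge0 ?invr_ge0 ?exprn_ge0 ?(ltW D0)//.
    congr (_ * _); rewrite -powR_inv1 ?exprn_ge0// -powRrM mulN1r.
    by rewrite powR_expAC.
  have -> : series_rate t p q b =
      2 `^ (b * p) * 2 `^ pair_rate t m * 2 `^ (- q).
    by rewrite /series_rate !powRD ?pnatr_eq0 ?implybT.
  rewrite /term_const -/m !exprMn le_eqVlt; apply/orP; left; apply/eqP; ring.
exists (fun w => (holder_const D p b)%:E * \sum_(0 <= k <oo) f k w)%E; split.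
- apply: emeasurable_funM => //.
  exact: (@ge0_emeasurable_sum _ _ _ _ _ predT).
- by move=> w; rewrite mule_ge0// nneseries_ge0.
- rewrite ge0_integralZl_EFin//; last 2 first.
  + by move=> w _; apply: nneseries_ge0.
  + exact: (@ge0_emeasurable_sum _ _ _ _ _ predT).
  rewrite integral_nneseries// /moment_const mulrCA EFinM.
  apply: lee_wpmul2l => //; rewrite mulrA.
  apply: nneseries_geometric_le => //.
  + by rewrite !mulr_ge0 ?powR_ge0// ltW.
  + exact: powR_ge0.
  + exact: series_rate_lt1.
  + by move=> k; apply: integral_ge0.
- move=> w i j eij.
  have dij : 0 < mdist (e i) (e j) by rewrite mdist_gt0; apply/eqP.
  have : (0 <= \sum_(0 <= k <oo) f k w)%E by apply: nneseries_ge0.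
  case E : (\sum_(0 <= k <oo) f k w)%E => [V| |//] V0; last first.
    by rewrite mulry gtr0_sg// mul1e leey.
  rewrite -EFinM lee_fin ler_pdivrMr ?powR_gt0//.
  apply: (holder_of_increments (f := X ^~ w) D0 p0 b0 _ Gc Ul) => //.
  by move=> k; rewrite -lee_fin -E (le_trans _ (nneseries_lim_ge k.+1 _))//
    big_nat_recr//= leeDr// sume_ge0.
Qed.

(** * Borel measurability in metric spaces *)

Section borel.
Context {d : measure_display} {Omega : measurableType d}.

Lemma borel_measurableP (S : topologicalType) (f : Omega -> S) :
  borel_measurable f <-> forall U, open U -> measurable (f @^-1` U).
Proof.
split=> [mf U oU|mf B]; first by apply: mf; exact: sub_sigma_algebra.
suff : <<s @open S >> `<=` [set B | measurable (f @^-1` B)] by apply.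
apply: smallest_sub => //; split => /=.
- by rewrite preimage_set0.
- by move=> A mA; rewrite setTD preimage_setC; exact: measurableC.
- by move=> F mF; rewrite preimage_bigcup; exact: bigcup_measurable.
Qed.

Lemma borel_measurable_comp (S S' : topologicalType) (g : S -> S')
    (f : Omega -> S) :
  continuous g -> borel_measurable f -> borel_measurable (g \o f).
Proof.
move=> /continuousP cg /borel_measurableP mf; apply/borel_measurableP => U oU.
by rewrite comp_preimage; exact/mf/cg.
Qed.

Lemma borel_measurable_if (S : topologicalType) (E : set Omega)
    (f g : Omega -> S) :
  measurable E -> borel_measurable f -> borel_measurable g ->
  borel_measurable (fun w => if w \in E then f w else g w).
Proof.
move=> mE mf mg B BB.
rewrite (_ : _ @^-1` B = (E `&` f @^-1` B) `|` (~` E `&` g @^-1` B)).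
  by apply: measurableU; apply: measurableI; [|exact: mf|exact: measurableC|exact: mg].
apply/seteqP; split=> w /=.
- by case: (boolP (w \in E)); rewrite (in_setE, notin_setE) => ?; [left|right].
- by case=> -[Ew fw]; [rewrite mem_set|rewrite memNset].
Qed.

(** A limit lies in the open set [U] iff, for some [r], the sequence is
    eventually in the interior of the set of points whose [r]-ball is included
    in [U].  No separability is involved, so this applies to pairs of maps with
    values in a non-separable space. *)
Lemma borel_measurable_cvg (R : realType) (S : pseudoMetricType R)
    (f : nat -> Omega -> S) (g : Omega -> S) :
  (forall n, borel_measurable (f n)) -> (forall w, f n w @[n --> \oo] --> g w) ->
  borel_measurable g.
Proof.
move=> mf fg; apply/borel_measurableP => U oU.
pose r k : R := k.+1%:R^-1.
pose I k := interior [set y | ball y (r k) `<=` U].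
rewrite (_ : g @^-1` U = \bigcup_k \bigcup_N \bigcap_(n in [set n | (N <= n)%N])
    f n @^-1` I k).
  apply: bigcup_measurable => k _; apply: bigcup_measurable => N _.
  apply: bigcap_measurableType => n _.
  by apply: (borel_measurableP _).1 => //; exact: open_interior.
apply/seteqP; split=> w.
- move=> Ugw.
  have /nbhs_ballP[e /= e0 eU] : nbhs (g w) U by exact: open_nbhs_nbhs.
  have [k ke] : exists k, r k < e / 2.
    exists (Num.truncn (e / 2)^-1); rewrite /r -[ltRHS]invrK ltf_pV2 ?posrE//.
      exact: truncnS_gt.
    by rewrite invr_gt0 divr_gt0.
  have Igw : nbhs (g w) (I k).
    apply: nbhs_interior; apply/nbhs_ballP; exists (e / 2) => /=.
      by rewrite divr_gt0.
    move=> y gy z yz; apply: eU; rewrite [e]splitr; apply: ball_triangle gy _.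
    by apply: le_ball yz; rewrite ltW.
  have [N _ NI] := fg w _ Igw.
  by exists k => //; exists N => // n Nn; exact: NI.
- move=> [k _ [N _ NI]].
  have rk0 : 0 < r k by rewrite invr_gt0.
  have [N' _ N'I] := fg w _ (nbhsx_ballx (g w) _ rk0).
  have /= := NI (maxn N N') (leq_maxl _ _).
  move=> /interior_subset; apply.
  by apply: ball_sym; apply: N'I => /=; exact: leq_maxr.
Qed.

End borel.

Lemma open_mdist_gt (R : realType) (S : metricType R) (a : R) :
  open [set z : S * S | a < mdist z.1 z.2].
Proof.
rewrite openE => -[x y] /= axy.
pose e := (mdist x y - a) / 2; have e0 : 0 < e by rewrite divr_gt0// subr_gt0.
exists (ball x e, ball y e); first by split; exact: nbhsx_ballx.
move=> [u v] /= []; rewrite !ballEmdist/= => xu yv.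
have := metric_triangle x u y; have := metric_triangle u v y.
rewrite (metric_sym v y); move: xu yv; rewrite /e; lra.
Qed.

Lemma measurable_mdist (R : realType) (d : measure_display)
    (Omega : measurableType d) (S : metricType R) (f g : Omega -> S) :
  borel_measurable (fun w => (f w, g w)) ->
  measurable_fun setT (fun w => mdist (f w) (g w)).
Proof.
move=> /borel_measurableP mfg.
apply: (measurability _ (RGenOInfty.measurableE R)) => // _ [_ [a ->] <-].
rewrite setTI (_ : _ @^-1` _ = (fun w => (f w, g w)) @^-1`
  [set z | a < mdist z.1 z.2]); first exact/mfg/open_mdist_gt.
by apply/seteqP; split=> w /=; rewrite in_itv/= andbT.
Qed.

Lemma measurable_coincidence (R : realType) (d : measure_display)
    (Omega : measurableType d) (S : metricType R) (f g : Omega -> S) :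
  borel_measurable (fun w => (f w, g w)) -> measurable [set w | f w = g w].
Proof.
move=> mfg; rewrite (_ : [set w | _] = (fun w => mdist (f w) (g w)) @^-1` [set 0]).
  by rewrite -[X in measurable X]setTI; exact: measurable_mdist.
by apply/seteqP; split=> w /= => [->|/mdist_positivity//]; rewrite mdistxx.
Qed.

(** * Almost sure events and integrals *)

Lemma ae_probability1 (R : realType) (d : measure_display)
    (Omega : measurableType d) (P : probability Omega R) (E : set Omega) :
  measurable E -> {ae P, forall w, E w} -> P E = 1%E.
Proof.
move=> mE; rewrite /almost_everywhere/= => nE.
have mEC : measurable (~` E) by exact: measurableC.
have /negligibleP : P.-negligible (~` E) by [].
move=> /(_ mEC) PE; have := probability_setC P mEC.
by rewrite setCK PE sube0.
Qed.

Lemma ae_lt_pinfty (R : realType) (d : measure_display)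
    (Omega : measurableType d) (mu : {measure set Omega -> \bar R})
    (W : Omega -> \bar R) :
  measurable_fun setT W -> (forall w, (0 <= W w)%E) ->
  (\int[mu]_w W w < +oo)%E -> {ae mu, forall w, (W w < +oo)%E}.
Proof.
move=> mW W0 intW.
have : mu.-integrable setT W.
  by apply/integrableP; split => //; under eq_integral do rewrite gee0_abs//.
move=> /(integrable_ae measurableT); apply: filterS => w /(_ Logic.I).
by rewrite ge0_fin_numE.
Qed.

(** The integral of a nonnegative function is a supremum over simple functions
    below it, so it is monotone for arbitrary functions; this spares the
    measurability of the supremum of the Hoelder quotients. *)
Lemma ge0_le_integral_any (R : realType) (d : measure_display)
    (Omega : measurableType d) (mu : {measure set Omega -> \bar R})
    (f g : Omega -> \bar R) :
  (forall w, (0 <= f w)%E) -> (forall w, (f w <= g w)%E) ->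
  (\int[mu]_w f w <= \int[mu]_w g w)%E.
Proof.
move=> f0 fg; have g0 w : (0 <= g w)%E by exact: le_trans (fg w).
rewrite !ge0_integralTE//; apply: ereal_sup_le => _ [h hf <-] /=.
by exists h => // w; exact: le_trans (fg w).
Qed.

(** * Extension from a dense sequence *)

Lemma countable_enumeration (T : Type) (A : set T) (x : T) :
  countable A -> A x ->
  exists e : nat -> T, (forall n, A (e n)) /\ forall y, A y -> exists n, e n = y.
Proof.
move=> /countable_injP[f finj] Ax.
have /choice[e eP] : forall n, exists y, A y /\ forall z, A z -> f z = n -> z = y.
  move=> n; have [[y [Ay yn]]|no] := pselect (exists y, A y /\ f y = n).
    by exists y; split => // z Az zn; apply: finj; rewrite ?inE// yn zn.
  by exists x; split => // z Az zn; case: no; exists z.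
exists e; split=> [n|y Ay]; first by have [] := eP n.
by exists (f y); have [_ /(_ y Ay erefl)] := eP (f y).
Qed.

Lemma dense_sequence (R : realType) (T : metricType R) (x : T) :
  totally_bounded [set: T] ->
  exists e : nat -> T, forall y eps, 0 < eps -> exists i, mdist y (e i) < eps.
Proof.
move=> tb; have pos n : (0 : R) < n.+1%:R^-1 by rewrite invr_gt0.
have /choice[F FP] n := tb _ (pos n).
pose A := \bigcup_n [set` F n].
have cA : countable A by apply: bigcup_countable => // n _; exact: countable_fset.
have [u uF _] := FP 0%N x Logic.I.
have Au : A u by exists 0%N.
have [e [_ eA]] := countable_enumeration cA Au.
exists e => y eps eps0.
have [v vF] := FP (Num.truncn eps^-1) y Logic.I.
rewrite ballEmdist/= => vy.
have [|i ei] := eA v; first by exists (Num.truncn eps^-1).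
exists i; rewrite ei metric_sym (lt_trans vy)//.
by rewrite -[ltRHS]invrK ltf_pV2 ?posrE ?invr_gt0// truncnS_gt.
Qed.

Lemma small_powR (R : realType) (K b eps : R) :
  0 <= K -> 0 < b -> 0 < eps ->
  exists2 dl, 0 < dl & forall y, 0 <= y -> y <= dl -> K * y `^ b < eps.
Proof.
move=> K0 b0 eps0; have K1 : 0 < K + 1 by rewrite ltr_wpDl.
exists ((eps / (K + 1)) `^ b^-1); first by rewrite powR_gt0// divr_gt0.
move=> y y0 yd.
have yb : y `^ b <= eps / (K + 1).
  have -> : eps / (K + 1) = ((eps / (K + 1)) `^ b^-1) `^ b.
    by rewrite -powRrM mulVf ?gt_eqF// powRr1// divr_ge0 ?(ltW eps0) ?(ltW K1).
  by rewrite ge0_ler_powR ?nnegrE ?(ltW b0) ?powR_ge0.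
apply: le_lt_trans (ler_wpM2l K0 yb) _.
by rewrite mulrA ltr_pdivrMr// mulrC ltr_pM2l// ltrDl.
Qed.

(** An upper bound of distances passes to the limit, as [mdist] exceeding [c] is
    an open condition on pairs. *)
Lemma mdist_lim_le (R : realType) (S : metricType R) (u v : nat -> S) (x y : S)
    (c : R) :
  u n @[n --> \oo] --> x -> v n @[n --> \oo] --> y ->
  (\forall n \near \oo, mdist (u n) (v n) <= c) -> mdist x y <= c.
Proof.
move=> ux vy uvc; rewrite leNgt; apply/negP => cxy.
have uv : (u n, v n) @[n --> \oo] --> (x, y) by exact: cvg_pair.
have : nbhs (x, y) [set z : S * S | c < mdist z.1 z.2].
  by apply: open_nbhs_nbhs; split => //; exact: open_mdist_gt.
move=> /uv cuv.
have {}cuv : \forall n \near \oo, c < mdist (u n) (v n) by exact: cuv.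
have [n [/=]] := filter_ex (filterI cuv uvc).
by rewrite ltNge => /negP.
Qed.

(** Any fixed rate would do: it makes [a n] close to [x] uniformly in [x]. *)
Definition fast_cvg (R : realType) (T : metricType R) (a : nat -> T) (x : T) :=
  forall n, mdist x (a n) < n.+1%:R^-1.

Lemma near_inv_small (R : realType) (eps : R) :
  0 < eps -> \forall n \near \oo, n.+1%:R^-1 <= eps.
Proof.
move=> eps0; exists (Num.truncn eps^-1) => // n /= nN.
rewrite -[leRHS]invrK lef_pV2 ?posrE ?invr_gt0//.
by rewrite (le_trans (ltW (truncnS_gt _)))// ler_nat ltnS.
Qed.

Lemma holder_cauchy (R : realType) (T S : metricType R) (f : T -> S) (K b : R)
    (a : nat -> T) (x : T) :
  0 <= K -> 0 < b -> fast_cvg a x ->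
  (forall n m, mdist (f (a n)) (f (a m)) <= K * mdist (a n) (a m) `^ b) ->
  cauchy (f (a n) @[n --> \oo]).
Proof.
move=> K0 b0 ax fa; apply: cauchy_exP => eps /= eps0.
have [dl dl0 dlP] := small_powR K0 b0 eps0.
have dl2 : 0 < dl / 2 by rewrite divr_gt0.
have [N _ NP] := near_inv_small dl2.
exists (f (a N)); exists N => // n /= Nn; rewrite ballEmdist/=.
apply: le_lt_trans (fa _ _) _; apply: dlP; first exact: mdist_ge0.
apply: le_trans (metric_triangle _ x _) _; rewrite (metric_sym _ x).
rewrite [dl]splitr lerD// ltW//.
  by apply: lt_le_trans (ax N) (NP _ _) => /=.
exact: lt_le_trans (ax n) (NP _ _).
Qed.

(** For [x <> x'] the approximations satisfy [mdist (a n) (a' n) <= 2 * mdist x x']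
    from some rank on; accepting the factor 2 avoids the continuity of powers. *)
Lemma holder_lim (R : realType) (T S : metricType R) (f : T -> S) (K b : R)
    (a a' : nat -> T) (x x' : T) (y y' : S) :
  0 <= K -> 0 < b -> fast_cvg a x -> fast_cvg a' x' ->
  f (a n) @[n --> \oo] --> y -> f (a' n) @[n --> \oo] --> y' ->
  (forall n, mdist (f (a n)) (f (a' n)) <= K * mdist (a n) (a' n) `^ b) ->
  x <> x' -> mdist y y' <= K * (2 * mdist x x') `^ b.
Proof.
move=> K0 b0 ax ax' fy fy' faa xx'.
have xx'0 : 0 < mdist x x' by rewrite mdist_gt0; exact/eqP.
have xx'2 : 0 < mdist x x' / 2 by rewrite divr_gt0.
apply: mdist_lim_le fy fy' _; apply: filterS (near_inv_small xx'2) => n nx.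
apply: le_trans (faa n) _; rewrite ler_wpM2l// ge0_ler_powR ?nnegrE ?(ltW b0)//.
- exact: mdist_ge0.
- by rewrite mulr_ge0// mdist_ge0.
have := metric_triangle (a n) x (a' n); have := metric_triangle x x' (a' n).
rewrite (metric_sym (a n) x); move: (ax n) (ax' n) nx.
by move: n.+1%:R^-1 => g; lra.
Qed.

Lemma holder_of_envelope (R : realType) (T S : metricType R) (f : T -> S)
    (e : nat -> T) (p b : R) (V : \bar R) :
  0 < p -> (0 <= V)%E -> (V < +oo)%E ->
  (forall i j, e i <> e j ->
     ((mdist (f (e i)) (f (e j)) `^ p / mdist (e i) (e j) `^ (b * p))%:E <= V)%E) ->
  exists2 K : R, 0 <= K &
    forall i j, mdist (f (e i)) (f (e j)) <= K * mdist (e i) (e j) `^ b.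
Proof.
move=> p0; case: V => [V| |//]; last by rewrite ltxx.
rewrite lee_fin => V0 _ fV.
exists (V `^ p^-1) => [|i j]; first exact: powR_ge0.
have [->|eij] := pselect (e i = e j).
  by rewrite mdistxx mulr_ge0// powR_ge0.
have eij0 : 0 < mdist (e i) (e j) by rewrite mdist_gt0; exact/eqP.
have := fV i j eij; rewrite lee_fin ler_pdivrMr ?powR_gt0// => h.
rewrite -[leLHS]powRr1 ?mdist_ge0// -(mulfV (lt0r_neq0 p0)) powRrM.
have -> : V `^ p^-1 * mdist (e i) (e j) `^ b =
    (V * mdist (e i) (e j) `^ (b * p)) `^ p^-1.
  rewrite powRM ?powR_ge0//; congr (_ * _).
  by rewrite -powRrM mulfK// gt_eqF.
by rewrite ge0_ler_powR ?nnegrE ?powR_ge0 ?mulr_ge0 ?powR_ge0 ?invr_ge0 ?(ltW p0).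
Qed.

(** * The modification *)

Lemma exponent_approx (R : realType) (g b : R) :
  0 < b -> b < g -> exists k, b <= g * (1 - k.+2%:R^-1).
Proof.
move=> b0 bg; have g0 : 0 < g by apply: lt_trans bg.
have gb0 : 0 < (g - b) / g by rewrite divr_gt0// subr_gt0.
have [k _ kP] := near_inv_small gb0; exists k.
have := kP k.+1 (leqnSn k).
rewrite ler_pdivlMr// mulrBr mulr1 (mulrC g).
by move: (k.+2%:R^-1 * g) => r; lra.
Qed.

(** The limits along the dense sequence, on the event where the paths are
    Hoelder on it for all the exponents [b k], which increase to
    [(q - t) / p]. *)
Lemma holder_modification (R : realType) (d : measure_display)
    (Omega : measurableType d) (P : probability Omega R)
    (Theta XX : metricType R) (X : Theta -> Omega -> XX) (D C t M p q : R)
    (x0 : Theta) :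
  0 < D -> 0 < C -> 0 < t -> 0 < M -> 0 < p -> t < q ->
  (forall x y : Theta, mdist x y <= D) ->
  (forall eta, 0 < eta -> eta <= D ->
     exists2 s : seq Theta, (size s)%:R <= C * eta `^ (- t) & covers s eta) ->
  totally_bounded [set: Theta] ->
  random_process X ->
  (forall x y, borel_measurable (fun w => (X x w, X y w))) ->
  (forall x y, (\int[P]_w (mdist (X x w) (X y w) `^ p)%:E
                 <= (M * mdist x y `^ q)%:E)%E) ->
  complete_metric XX ->
  exists Xt : Theta -> Omega -> XX,
    [/\ modification P X Xt,
        forall x y, borel_measurable (fun w => (Xt x w, Xt y w)) &
        forall w b, 0 < b -> b < (q - t) / p ->
          holder_continuous b (fun x => Xt x w)].
Proof.
move=> D0 C0 t0 M0 p0 tq diamD nets tb mX mXX momX cXX.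
have mdX x y := measurable_mdist (mXX x y).
set g := (q - t) / p; have g0 : 0 < g by rewrite divr_gt0// subr_gt0.
pose b k := g * (1 - k.+2%:R^-1).
have b0 k : 0 < b k by rewrite mulr_gt0// subr_gt0 invf_lt1 ?ltr1n.
have bg k : b k < g by rewrite /b mulrBr mulr1 ltrBlDr ltrDl mulr_gt0// invr_gt0.
have [e edense] := dense_sequence x0 tb.
have env (u : nat -> Theta) k := holder_envelope u D0 C0 t0 M0 p0 (b0 k) (bg k)
  diamD nets mdX momX.
have envfin (W : Omega -> \bar R) c : measurable_fun setT W ->
    (forall w, (0 <= W w)%E) -> (\int[P]_w W w <= c%:E)%E ->
    {ae P, forall w, (W w < +oo)%E}.
  move=> mW W0 Wc; apply: ae_lt_pinfty => //.
  by apply: le_lt_trans Wc _; exact: ltry.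
have /choice[W WP] := env e.
pose E := \bigcap_k [set w | (W k w < +oo)%E].
have mE : measurable E.
  apply: bigcap_measurableType => k _; have [mW _ _ _] := WP k.
  by rewrite -[X in measurable X]setTI; exact: emeasurable_fun_infty_o.
have aeE : {ae P, forall w, E w}.
  have : forall k, {ae P, forall w, (W k w < +oo)%E}.
    by move=> k; have [mW W0 iW _] := WP k; exact: envfin iW.
  by move=> /ae_foralln; apply: filterS => w Ew k _; exact: Ew.
have PE : P E = 1%E by exact: ae_probability1.
have [w0 _] : E !=set0.
  apply/set0P/eqP => E0; move: PE; rewrite E0 measure0 => /eqP.
  by rewrite eq_sym onee_eq0.
have holdE w k : E w -> exists2 K : R, 0 <= K & forall i j,
    mdist (X (e i) w) (X (e j) w) <= K * mdist (e i) (e j) `^ b k.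
  move=> Ew; have [_ W0 _ WX] := WP k.
  exact: (holder_of_envelope (f := X ^~ w) p0 (W0 w) (Ew k Logic.I) (WX w)).
have /choice[a aP] : forall x, exists a : nat -> nat, fast_cvg (e \o a) x.
  move=> x; suff /choice[a aP] : forall n, exists i, mdist x (e i) < n.+1%:R^-1.
    by exists a => n; exact: aP.
  by move=> n; apply: edense; rewrite invr_gt0.
(* constant outside E, so that Y n x converges everywhere *)
pose Y n x w := if w \in E then X (e (a x n)) w else X x0 w0.
have Ycvg x w : exists l : XX, Y n x w @[n --> \oo] --> l.
  rewrite /Y; case: (boolP (w \in E)) => [|_]; last first.
    by exists (X x0 w0); exact: cvg_cst.
  rewrite inE => Ew; apply: cXX; have [K K0 KX] := holdE w 0%N Ew.
  exact: (holder_cauchy (f := X ^~ w) K0 (b0 0%N) (aP x) (fun n m => KX _ _)).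
have /choice[Xt XtP] : forall x, exists h : Omega -> XX,
    forall w, Y n x w @[n --> \oo] --> h w.
  by move=> x; have /choice[h hP] := Ycvg x; exists h.
have mYf n x (f : Omega -> XX) :
    (forall y, borel_measurable (fun w => (X y w, f w))) ->
    borel_measurable f -> borel_measurable (fun w => (Y n x w, f w)).
  move=> Xf mf; rewrite (_ : (fun w => _) = fun w =>
      if w \in E then (X (e (a x n)) w, f w) else (X x0 w0, f w)).
    apply: borel_measurable_if => //.
    apply: (@borel_measurable_comp _ _ _ _ (fun z => (X x0 w0, z))) => //.
    by move=> z; apply: cvg_pair; [exact: cvg_cst|exact: cvg_id].
  by apply/funext => w; rewrite /Y; case: ifP.
have mXtf x (f : Omega -> XX) :
    (forall y, borel_measurable (fun w => (X y w, f w))) ->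
    borel_measurable f -> borel_measurable (fun w => (Xt x w, f w)).
  move=> Xf mf; apply: (@borel_measurable_cvg _ _ _ _
    (fun n w => (Y n x w, f w))) => [n|w]; first exact: mYf.
  by apply: cvg_pair; [exact: XtP|exact: cvg_cst].
have flip (f h : Omega -> XX) : borel_measurable (fun w => (f w, h w)) ->
    borel_measurable (fun w => (h w, f w)).
  by move=> mfh; exact: (borel_measurable_comp swap_continuous mfh).
have mXt x : borel_measurable (Xt x).
  have := mXtf x (X x0) (fun y => mXX y x0) (mX x0).
  apply: (@borel_measurable_comp _ _ _ _ fst).
  by move=> z; exact: cvg_fst.
exists Xt; split.
- split=> [//|x].
  have mx : measurable [set w | Xt x w = X x w].
    by apply/measurable_coincidence/mXtf.
  split=> //; apply: ae_probability1 => //.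
  (* adding x to the dense sequence compares the limit with X x *)
  pose u n := if n is n'.+1 then e n' else x.
  have [W' [mW' W'0 iW' W'X]] := env u 0%N.
  have := envfin _ _ mW' W'0 iW'; apply: filterS2 aeE => w Ew W'w.
  have [K K0 KX] :=
    holder_of_envelope (f := X ^~ w) p0 (W'0 w) W'w (W'X w).
  have cX : Y n x w @[n --> \oo] --> X x w.
    apply/metricType_numDomainType.cvgrPdist_lt => eps eps0.
    have [dl dl0 dlP] := small_powR K0 (b0 0%N) eps0.
    apply: filterS (near_inv_small dl0) => n ndl; rewrite /Y mem_set//.
    apply: le_lt_trans (KX 0%N (a x n).+1) _; apply: dlP.
      exact: mdist_ge0.
    by apply: le_trans ndl; exact: ltW (aP x n).
  exact: (cvg_unique (@metric_hausdorff _ XX) (XtP x w) cX).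
- move=> x y; apply: (mXtf) => // z; apply: flip; exact: mXtf.
- move=> w b' b'0 b'g; have [k bk] := exponent_approx b'0 b'g.
  have [Ew|Ew] := pselect (E w); last first.
    exists 0 => x y; rewrite mul0r.
    have cst z : Xt z w = X x0 w0.
      apply: (cvg_unique (@metric_hausdorff _ XX) (XtP z w)).
      by rewrite /Y memNset//; exact: cvg_cst.
    by rewrite !cst mdistxx.
  have [K K0 KX] := holdE w k Ew.
  exists (K * 2 `^ b k * D `^ (b k - b')) => x y.
  have [<-|xy] := pselect (x = y).
    by rewrite mdistxx !mulr_ge0 ?powR_ge0.
  have xy0 : 0 < mdist x y by rewrite mdist_gt0; exact/eqP.
  have YX z : X (e (a z n)) w @[n --> \oo] --> Xt z w.
    by have := XtP z w; rewrite /Y mem_set.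
  apply: le_trans (holder_lim (f := X ^~ w) K0 (b0 k) (aP x) (aP y)
    (YX x) (YX y) _ xy) _ => [n|]; first exact: KX.
  rewrite powRM// ?mdist_ge0// -!mulrA !ler_wpM2l ?powR_ge0//.
  rewrite -[X in mdist x y `^ X](subrK b') powRD; last first.
    by rewrite (gt_eqF xy0) implybT.
  rewrite ler_wpM2r ?powR_ge0// ge0_ler_powR ?nnegrE ?subr_ge0 ?mdist_ge0//.
  exact: ltW.
Qed.

(** * Diameter and covering numbers *)

Section diameter.
Context {R : realType} {T : metricType R}.

Lemma mdist_le_diam (A : set T) x y : A x -> A y -> ((mdist x y)%:E <= diam A)%E.
Proof. by move=> Ax Ay; apply: ereal_sup_ubound; right; exists (x, y). Qed.

Lemma diam_ge0 (A : set T) : (0 <= diam A)%E.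
Proof. by apply: ereal_sup_ubound; left. Qed.

Lemma diam_gt0_inhabited (A : set T) : (0 < diam A)%E -> exists x, A x.
Proof.
move=> A0; apply: contrapT => noA; move: A0; rewrite ltNge => /negP; apply.
by apply: ge_ereal_sup => _ [->//|[[x y] [/= Ax _] <-]]; case: noA; exists x.
Qed.

(** The factor 2 leaves room for an infimum that is not known to be attained. *)
Lemma net_of_covering_number (C eta : R) : 0 < C -> 0 < eta ->
  (covering_number [set: T] eta <= C%:E)%E ->
  exists2 s : seq T, (size s)%:R <= 2 * C & covers s eta.
Proof.
move=> C0 eta0 NC.
have /ereal_inf_lt[_ [F [_ FT] <-] FC] :
    (covering_number [set: T] eta < (2 * C)%:E)%E.
  by apply: le_lt_trans NC _; rewrite lte_fin; lra.
exists (F : seq T); first by rewrite ltW// -lte_fin.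
move=> x; have [u uF ux] := FT x Logic.I.
by exists u; rewrite // metric_sym.
Qed.

(** With an infinite diameter the covering bound would hold for all radii, and a
    large one would give a cover by less than one ball. *)
Lemma diam_lt_pinfty (C t : R) : 0 < C -> 0 < t ->
  (forall eta : R, 0 < eta -> (eta%:E <= diam [set: T])%E ->
     (covering_number [set: T] eta <= (C * eta `^ (- t))%:E)%E) ->
  (diam [set: T] < +oo)%E.
Proof.
move=> C0 t0 NC; rewrite ltey; apply/eqP => Doo.
have [x _] : exists x : T, [set: T] x by apply: diam_gt0_inhabited; rewrite Doo.
have C1 : 0 < 4 * C by rewrite mulr_gt0.
pose eta := (4 * C) `^ t^-1; have eta0 : 0 < eta by rewrite powR_gt0.
have := NC eta eta0; rewrite Doo leey => /(_ isT).
have -> : C * eta `^ (- t) = 4^-1.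
  rewrite -powRrM mulrN mulVf ?gt_eqF// powR_inv1 ?(ltW C1)//.
  by field; rewrite gt_eqF.
move=> /(net_of_covering_number _ eta0)[|s]; first by rewrite invr_gt0.
case: s => [_ /(_ x)[u]//|u s /=].
by rewrite -natr1 => s1 _; have := ler0n R (size s); lra.
Qed.

End diameter.

Theorem theorem1p1 (R : realType) :
  exists Lbar : \bar R -> R -> R -> R -> R -> R -> R,
  forall (Theta XX : metricType R) (d : measure_display)
    (Omega : measurableType d) (P : probability Omega R)
    (X : Theta -> Omega -> XX) (C t M p q : R),
  totally_bounded [set: Theta] ->
  random_process X ->
  0 < C -> 0 < t ->
  (forall eta : R, 0 < eta -> (eta%:E <= diam [set: Theta])%E ->
     (covering_number [set: Theta] eta <= (C * eta `^ (- t))%:E)%E) ->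
  (forall theta vartheta : Theta, theta <> vartheta ->
     borel_measurable (fun w => (X theta w, X vartheta w))) ->
  0 < M -> 0 < p -> t < q ->
  (forall theta vartheta : Theta,
     ('E_P[(fun w => (mdist (X theta w) (X vartheta w) `^ p)%R)]
        <= (M * mdist theta vartheta `^ q)%:E)%E) ->
  (forall beta : R, 0 < beta -> beta < (q - t) / p ->
     forall A : set Theta, countable A -> (0 < diam A)%E ->
     (\int[P]_w ereal_sup
        [set (mdist (X z.1 w) (X z.2 w) `^ p
                / mdist z.1 z.2 `^ (beta * p))%:E
         | z in [set z | [/\ A z.1, A z.2 & z.1 <> z.2]]]
      <= (M * Lbar (diam [set: Theta]) C t p q beta)%:E)%E) /\
  (complete_metric XX ->
     exists Xt : Theta -> Omega -> XX,
       [/\ modification P X Xt,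
           forall theta vartheta : Theta, theta <> vartheta ->
             borel_measurable (fun w => (Xt theta w, Xt vartheta w)) &
           forall (w : Omega) (beta : R), 0 < beta -> beta < (q - t) / p ->
             holder_continuous beta (fun theta => Xt theta w)]).
Proof.
exists (fun D C t p q b => moment_const (fine D) (2 * C) t p q b).
move=> Theta XX d Omega P X C t M p q tb mX C0 t0 NC mXX M0 p0 tq EX.
have C20 : 0 < 2 * C by rewrite mulr_gt0.
have dfin : diam [set: Theta] \is a fin_num.
  by rewrite ge0_fin_numE ?diam_ge0//; exact: diam_lt_pinfty NC.
set D := fine (diam [set: Theta]).
have DE : diam [set: Theta] = D%:E by rewrite fineK.
have diamD (x y : Theta) : mdist x y <= D by rewrite -lee_fin -DE mdist_le_diam.
have nets eta : 0 < eta -> eta <= D ->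
    exists2 s : seq Theta, (size s)%:R <= 2 * C * eta `^ (- t) & covers s eta.
  move=> eta0 etaD; rewrite -mulrA; apply: net_of_covering_number => //.
    by rewrite mulr_gt0// powR_gt0.
  by apply: NC => //; rewrite DE lee_fin.
have mXX' x y : borel_measurable (fun w => (X x w, X y w)).
  have [<-|] := pselect (x = y); last exact: mXX.
  apply: (@borel_measurable_comp _ _ _ _ (fun z => (z, z))) (mX x).
  by move=> z; apply: cvg_pair; exact: cvg_id.
have momX x y : (\int[P]_w (mdist (X x w) (X y w) `^ p)%:E
    <= (M * mdist x y `^ q)%:E)%E by have := EX x y; rewrite unlock.
split.
- move=> b b0 bq A cA dA; have [x Ax] := diam_gt0_inhabited dA.
  have D0 : 0 < D.
    rewrite -lte_fin -DE (lt_le_trans dA)//.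
    apply: ereal_sup_le => _ [->|[z _ <-]]; [by left|by right; exists z].
  have [e [eA Ae]] := countable_enumeration cA Ax.
  have [W [mW W0 iW WX]] := holder_envelope e D0 C20 t0 M0 p0 b0 bq diamD nets
    (fun x y => measurable_mdist (mXX' x y)) momX.
  apply: le_trans iW.
  have [[y [Ay xy]]|A1] := pselect (exists y, A y /\ x <> y); last first.
    move: dA; rewrite ltNge => /negP; case; apply: ge_ereal_sup.
    have Ax1 z : A z -> z = x.
      by move=> Az; apply: contrapT => zx; apply: A1; exists z; split => // /esym.
    by move=> _ [->//|[[z z'] [/= /Ax1-> /Ax1->] <-]]; rewrite mdistxx.
  apply: ge0_le_integral_any => w.
    apply: le_trans (ereal_sup_ubound _); last by exists (x, y).
    by rewrite lee_fin divr_ge0// powR_ge0.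
  apply: ge_ereal_sup => _ [[u v] [/= /Ae[i <-] /Ae[j <-] uv] <-].
  exact: WX.
- move=> cXX.
  have [[x0]|noT] := pselect (exists x : Theta, True); last first.
    exists X; split=> [|x|w b _ _]; [split=> // x| |exists 0 => x];
      by case: noT; exists x.
  move=> _; have [D0|D0] := leP D 0.
    exists X; split=> // [|w b _ _].
      split=> // x; rewrite (_ : [set w | _] = setT); last exact/seteqP.
      by split; [exact: measurableT|exact: probability_setT].
    exists 0 => x y; rewrite mul0r (_ : x = y) ?mdistxx//.
    apply: mdist_positivity; apply/eqP.
    by rewrite eq_le mdist_ge0 (le_trans (diamD x y)).
  have [Xt [Xm XtXt Xth]] := holder_modification x0 D0 C20 t0 M0 p0 tq diamD nets
    tb mX mXX' momX cXX.
  by exists Xt; split => // w b; exact: Xth.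
Qed.
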